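(* Fix $\lambda=(\lambda^1,\dots,\lambda^d)\in\mathbb{R}^d$ with positive entries and $x\in\mathbb{R}^d$, and consider the linear path $X_t=tx$. For $s\le t$, its EFM-signature $\mathbb{X}^\lambda_{s,t}$ and $\mathbb{X}^\lambda_t:=\mathbb{X}^\lambda_{-\infty,t}$ are given by $$\mathbb{X}^\lambda_{s,t}=\exp^{\otimes}\Big(\sum_{k\ge1}\Omega_k(s,t)\Big),\qquad \mathbb{X}^\lambda_t=\exp^{\otimes}\Big(\sum_{k\ge1}\Omega_k(-\infty,t)\Big)=\sum_{k\ge0}\mathbf{H}_x^k\varnothing,$$ where $\Omega_k(s,t)$ are the Magnus terms (defined in the context) associated with $A(u)=\mathbf{D}^\lambda_{t-u}x$, and $\mathbf{H}_x:\ell\mapsto\mathbf{\Lambda}^\dagger(\ell\otimes x)$. For each word $v=i_1\cdots i_n$ the coefficients are given explicitly by $$\mathbb{X}^{\lambda,v}_{s,t}=(x^{i_1}\cdots x^{i_n})\sum_{k=0}^nc_ke^{-\mu_k(t-s)},\qquad \mathbb{X}^{\lambda,v}_t=(x^{i_1}\cdots x^{i_n})\prod_{k=1}^n\frac1{\mu_k},$$ where $\mu_0=0$, $\mu_k=\sum_{j=1}^k\lambda^{i_j}$ and $c_k=\prod_{l\ne k}\frac1{\mu_l-\mu_k}$ ($l$ ranging over $\{0,\dots,n\}\setminus\{k\}$). Moreover, if $\lambda^1=\dots=\lambda^d=:\bar\lambda$, then $$\mathbb{X}^\lambda_{s,t}=\exp^\otimes\Big(\frac{1-e^{-\bar\l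ambda(t-s)}}{\bar\lambda}\,x\Big),\qquad\mathbb{X}^\lambda_t=\exp^\otimes\Big(\frac{x}{\bar\lambda}\Big).$$
   Context: $T((\mathbb{R}^d))$ is the space of sequences $\ell=(\ell^n)_{n\ge0}$, $\ell^n\in(\mathbb{R}^d)^{\otimes n}$, written $\ell=\sum_v\ell^vv$ over words $v$ in letters $\{1,\dots,d\}$, with $i_1\cdots i_n$ identified with $e_{i_1}\otimes\cdots\otimes e_{i_n}$ and $\varnothing$ the empty word. $(p\otimes q)^v=\sum_{uw=v}p^uq^w$; $\exp^\otimes(\ell)=\sum_{k\ge0}\ell^{\otimes k}/k!$. Vectors $x\in\mathbb{R}^d$ are viewed as elements of level $1$. For $v=i_1\cdots i_n$, $\lambda^v=\sum_k\lambda^{i_k}$. Operators: $\mathbf{D}^\lambda_h\ell=\sum_ve^{-\lambda^vh}\ell^vv$ and $\mathbf{\Lambda}^\dagger\ell=\sum_{v\neq\varnothing}\frac1{\lambda^v}\ell^vv$. EFM-signature of an absolutely continuous path: for $-\infty\le s\le t$, $$\mathbb{X}^{\lambda,i_1\cdots i_n}_{s,t}=\int_{s<u_1<\cdots<u_n<t}e^{-\lambda^{i_1}(t-u_1)}\cdots e^{-\lambda^{i_n}(t-u_n)}\,dX^{i_1}_{u_1}\cdots dX^{i_n}_{u_n},\qquad\mathbb{X}^{\lambda,\varnothing}_{s,t}=1.$$ Magnus terms. With $A(\cdot)$ a fixed function (here $A(u)=\mathbf{D}^\lambda_{t-u}x$ with $t$ fixed), let $[p,q]:=q\otimes p-p\otimes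 q$ (the inverse commutator), $\mathrm{ad}_BA:=[B,A]$, and $B_j$ the Bernoulli numbers given by $\frac{z}{e^z-1}=\sum_{n\ge0}\frac{B_n}{n!}z^n$. Then $\Omega_1(s,r)=\int_s^rA(u)\,du$ and for $n\ge2$ $$\Omega_n(s,r)=\sum_{j=1}^{n-1}\frac{B_j}{j!}\sum_{\substack{k_1+\cdots+k_j=n-1\\k_1,\dots,k_j\ge1}}\int_s^r\mathrm{ad}_{\Omega_{k_1}(s,u)}\cdots\mathrm{ad}_{\Omega_{k_j}(s,u)}A(u)\,du ,$$ evaluated at $r=t$. All series are understood level by level in $T((\mathbb{R}^d))$. *)

(* Defs.v *)
From HB Require Import structures.
From mathcomp Require Import all_boot all_order all_algebra.
From mathcomp Require Import all_classical all_reals all_analysis.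
From mathcomp Require Import ring.

Set Implicit Arguments.
Unset Strict Implicit.
Unset Printing Implicit Defensive.

Import Order.TTheory GRing.Theory Num.Theory.
Import numFieldNormedType.Exports.

Local Open Scope classical_set_scope.
Local Open Scope ring_scope.

(* Letters are 'I_d.  An element l of T((R^d)) is given by its coefficients
   l^v on words v; its level n is the restriction of l to words of size n.
   Functions into R already carry the pointwise Z-module structure, so 0, +, -
   and \sum are the operations of T((R^d)).  The product is [tmul] below, not
   the pointwise product of functions. *)
Definition word (d : nat) := seq 'I_d.
Definition tens (R : realType) (d : nat) := word d -> R.

Definition tone (R : realType) (d : nat) : tens R d :=
  fun v => (v == [::])%:R.

Definition tvec (R : realType) (d : nat) (x : 'rV[R]_d) : tens R d :=
  fun v => if v is [:: i] then x 0 i else 0.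

Definition tscale (R : realType) (d : nat) (a : R) (p : tens R d) : tens R d :=
  fun v => a * p v.

Definition tmul (R : realType) (d : nat) (p q : tens R d) : tens R d :=
  fun v => \sum_(k < (size v).+1) p (take k v) * q (drop k v).

Definition tpow (R : realType) (d : nat) (p : tens R d) (k : nat) : tens R d :=
  iter k (tmul p) (@tone R d).

(* [tsum f] is meaningful only under [tsummable f], [lim] being total. *)
Definition tsummable (R : realType) (d : nat) (f : nat -> tens R d) : Prop :=
  forall v, cvgn (series (fun k => f k v)).

Definition tsum (R : realType) (d : nat) (f : nat -> tens R d) : tens R d :=
  fun v => limn (series (fun k => f k v)).

Definition texp (R : realType) (d : nat) (p : tens R d) : tens R d :=
  tsum (fun k => tscale (k`!%:R^-1) (tpow p k)).

(* lambda^v, the sum of the weights of the letters of v *)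
Definition wweight (R : realType) (d : nat) (lambda : 'rV[R]_d) (v : word d)
    : R :=
  \sum_(i <- v) lambda 0 i.

Definition tD (R : realType) (d : nat) (lambda : 'rV[R]_d) (h : R)
    (p : tens R d) : tens R d :=
  fun v => expR (- (wweight lambda v * h)) * p v.

Definition tLambda_dag (R : realType) (d : nat) (lambda : 'rV[R]_d)
    (p : tens R d) : tens R d :=
  fun v => if v is [::] then 0 else (wweight lambda v)^-1 * p v.

Definition tH (R : realType) (d : nat) (lambda x : 'rV[R]_d) (p : tens R d)
    : tens R d :=
  tLambda_dag lambda (tmul p (tvec x)).

(* The left endpoint s is an extended real, s = -oo giving the improper
   integrals over ]-oo, r[. *)
Definition time_int (R : realType) (s : \bar R) (r : R) : set R :=
  [set u : R | (s < u%:E)%E /\ u < r].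

Definition tint (R : realType) (d : nat) (s : \bar R) (r : R)
    (F : R -> tens R d) : tens R d :=
  fun v => (\int[@lebesgue_measure R]_(u in time_int s r) F u v)%R.

(* Iterated integral over s < u_1 < ... < u_n < r with weights
   e^{-lambda^{i_k}(t - u_k)}, for the word i_1 ... i_n given in reverse order
   (outermost integration variable u_n first).  The path X is meant to be
   absolutely continuous, so that dX^i_u = (X^i)'(u) du. *)
Fixpoint efm_iter (R : realType) (d : nat) (lambda : 'rV[R]_d)
    (X : R -> 'rV[R]_d) (s : \bar R) (t : R) (w : word d) (r : R) : R :=
  if w is i :: w' then
    (\int[@lebesgue_measure R]_(u in time_int s r)
       (efm_iter lambda X s t w' u * expR (- (lambda 0 i * (t - u)))
        * derive1 (fun u' : R => X u' 0 i) u))%R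
  else 1.

Definition efm_sig (R : realType) (d : nat) (lambda : 'rV[R]_d)
    (X : R -> 'rV[R]_d) (s : \bar R) (t : R) : tens R d :=
  fun v => efm_iter lambda X s t (rev v) t.

(* Recursion with fuel m; only the values at n < m matter. *)
Fixpoint bernoulli_rec (R : realType) (m n : nat) : R :=
  if m is m'.+1 then
    if n is 0%N then 1
    else - (n.+1%:R^-1 *
            \sum_(k < n) 'C(n.+1, k)%:R * bernoulli_rec R m' k)
  else 0.

Definition bernoulli (R : realType) (n : nat) : R := bernoulli_rec R n.+1 n.

Lemma bernoulli_rec_irr (R : realType) (m n : nat) :
  (n < m)%N -> bernoulli_rec R m n = bernoulli R n.
Proof.
suff H m1 m2 k : (k < m1)%N -> (k < m2)%N ->
    bernoulli_rec R m1 k = bernoulli_rec R m2 k by move=> nm; apply: H.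
elim: m1 m2 k => [|m1 IH] [|m2] [|k]//= k1 k2.
congr (- (_ * _)); apply: eq_bigr => i _; congr (_ * _).
by apply: IH; apply: (leq_trans (ltn_ord i)).
Qed.

(* z = (e^z - 1) * \sum_k B_k / k! z^k as formal power series, i.e. equality of
   the coefficients of z^n, where e^z - 1 = \sum_(j >= 1) z^j / j!. *)
Lemma bernoulli_genfun (R : realType) (n : nat) :
  \sum_(k < n.+1)
     bernoulli R k / k`!%:R * ((0 < n - k)%:R / (n - k)`!%:R) = (n == 1%N)%:R.
Proof.
rewrite big_ord_recr /= subnn ltnn mul0r mulr0 addr0.
case: n => [|[|n]]; first by rewrite big_ord0.
  by rewrite big_ord1 /= /bernoulli /= subn0 fact0 !divr1 mulr1.
have nz k : (k`!%:R : R) != 0 by rewrite pnatr_eq0 -lt0n fact_gt0.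
apply: (mulfI (nz n.+2)).
rewrite mulr0 mulr_sumr.
rewrite (eq_bigr (fun k : 'I_n.+2 => 'C(n.+2, k)%:R * bernoulli R k)).
  rewrite big_ord_recr /= -bin_sub// subSnn bin1 {2}/bernoulli.
  rewrite /= mulrN mulrA mulfV ?pnatr_eq0// mul1r.
  apply/eqP; rewrite subr_eq0; apply/eqP/eq_bigr => i _.
  by congr (_ * _); rewrite -(bernoulli_rec_irr R (ltn_ord i)).
move=> k _; rewrite subn_gt0 ltn_ord mul1r.
rewrite -(bin_fact (ltnW (ltn_ord k))) !natrM.
have a := nz k; have b := nz (n.+2 - k)%N.
by field; rewrite a b.
Qed.

(* inverse commutator: [p, q] = q (x) p - p (x) q *)
Definition tad (R : realType) (d : nat) (p q : tens R d) : tens R d :=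
  tmul q p - tmul p q.

(* Right-hand side of the Magnus recursion for Omega_n, n >= 2, in terms of the
   lower-order terms [Om k]; the tuples k range over the compositions
   k_1 + ... + k_j = n - 1 with all k_i >= 1. *)
Definition magnus_rhs (R : realType) (d : nat) (s : \bar R)
    (A : R -> tens R d) (Om : nat -> R -> tens R d) (n : nat) (r : R)
    : tens R d :=
  \sum_(1 <= j < n)
    tscale (bernoulli R j / j`!%:R)
      (\sum_(k : j.-tuple 'I_n | all (fun ki : 'I_n => 0 < ki)%N k
                                 && (\sum_(ki <- k) ki == n.-1)%N)
         tint s r (fun u =>
           foldr (fun (ki : 'I_n) (B : tens R d) => tad (Om ki u) B) (A u) k)).

(* Recursion with fuel m; only the values at 1 <= n <= m matter. *)
Fixpoint magnus_rec (R : realType) (d : nat) (s : \bar R)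
    (A : R -> tens R d) (m n : nat) (r : R) : tens R d :=
  if m is m'.+1 then
    if n == 1%N then tint s r A
    else magnus_rhs s A (magnus_rec s A m') n r
  else 0.

(* Omega_n(s, r), for n >= 1 *)
Definition magnus (R : realType) (d : nat) (s : \bar R)
    (A : R -> tens R d) (n : nat) (r : R) : tens R d :=
  magnus_rec s A n n r.

Lemma magnus1 (R : realType) (d : nat) (s : \bar R) (A : R -> tens R d)
    (r : R) :
  magnus s A 1 r = tint s r A.
Proof. by []. Qed.

Lemma magnus_rhs_eq (R : realType) (d : nat) (s : \bar R) (A : R -> tens R d)
    (Om Om' : nat -> R -> tens R d) (n : nat) (r : R) :
  (forall k, (0 < k < n)%N -> Om k = Om' k) ->
  magnus_rhs s A Om n r = magnus_rhs s A Om' n r.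
Proof.
move=> H; rewrite /magnus_rhs; apply: eq_bigr => j _; congr tscale.
apply: eq_bigr => k /andP[/allP k0 _]; congr tint; apply/funext => u.
elim: (tval k) k0 => //= a l IH k0; rewrite IH; last first.
  by move=> i il; apply: k0; rewrite inE il orbT.
by rewrite H// ltn_ord andbT; apply: k0; rewrite inE eqxx.
Qed.

Lemma magnus_rec_irr (R : realType) (d : nat) (s : \bar R)
    (A : R -> tens R d) (m n : nat) :
  (0 < n <= m)%N -> magnus_rec s A m n = magnus s A n.
Proof.
suff H m1 m2 k : (0 < k <= m1)%N -> (0 < k <= m2)%N ->
    magnus_rec s A m1 k = magnus_rec s A m2 k.
  by move=> /andP[n0 nm]; apply: H; rewrite n0/=.
elim: m1 m2 k => [|m1 IH] [|m2] [|k]//= k1 k2.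
apply/funext => r; case: ifP => // _; apply: magnus_rhs_eq => i /andP[i0 ik].
by apply: IH; rewrite i0 /= -ltnS; apply: (leq_trans ik); rewrite ?k1 ?k2.
Qed.

Lemma magnusE (R : realType) (d : nat) (s : \bar R) (A : R -> tens R d)
    (n : nat) (r : R) :
  (1 < n)%N -> magnus s A n r = magnus_rhs s A (magnus s A) n r.
Proof.
case: n => [|[|n]]// _; rewrite /magnus /=.
apply: magnus_rhs_eq => k kn; apply: (@magnus_rec_irr R d s A n.+1 k).
exact: kn.
Qed.

(* Main.v *)
Require Import Defs.
From HB Require Import structures.
From mathcomp Require Import all_boot all_order all_algebra.
From mathcomp Require Import all_classical all_reals all_analysis.
From mathcomp Require Import measurable_realfun ring.
Set Implicit Arguments.
Unset Strict Implicit.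
Unset Printing Implicit Defensive.
Import Order.TTheory GRing.Theory Num.Theory.
Import numFieldNormedType.Exports.
Local Open Scope classical_set_scope.
Local Open Scope ring_scope.

(** Read coefficientwise, the signature is the solution of a linear equation:
    the coefficient of a word [w i] at time [r] is the integral over (s, r) of
    the coefficient of [w] times e^(-lambda_i (t - u)) x_i.  Hence any family
    [Y] of series with [Y r [::] = 1] whose coefficients satisfy these
    integral equations is the signature (lemma [efm_sigE]), and every formula
    of the theorem is obtained by exhibiting such a [Y].

    All the functions of time that occur are finite combinations of
    exponentials e^(a u) with a > 0, up to constants coming from the left
    endpoint.  For these, [primitive s F f] records that [F] is the primitive
    of [f] that vanishes at [s], the boundary value of e^(a u), a > 0, at -oo
    being 0.  This relation is linear and satisfies the Leibniz rule ([primM]), which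
    holds by algebra on pairs of exponentials, so that finite and infinite
    starting times are treated at once and the only analytic input is the
    integral of one exponential ([Rintegral_expR]).

    For the Magnus formula, T((R^d)) is a ring, [ncseries], in which [tad w] is
    the operator c |-> c w - w c.  Let W solve W' = sum_j B_j/j! ad_W^j A.  The
    n-th power of W has derivative sum_i W^i W' W^(n-1-i), which the binomial
    identity [sum_pow_conj] rewrites in terms of the W^p ad_W^q W'; the
    convolution identity for Bernoulli numbers ([bernoulli_convol]) then
    collapses everything to (exp W)' = (exp W) A ([dexp_dexp_inv]).  It remains
    to see that the sum W of the Magnus terms solves this equation: the n-th
    term is homogeneous of degree n ([magnus_level]), so the coefficient of a
    word of length n of W is that of the n-th term alone, and expanding
    ad_W^j A into homogeneous parts gives back the sum over compositions of
    n - 1 in the recursion ([dexp_inv_magnus_sum]).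

    For the explicit coefficients, integrating the combination of exponentials
    for [w] gives the right one for [w i] except for the constant term, which
    is matched by the vanishing of sum_k prod_(l != k) 1 / (mu_l - mu_k)
    ([sum_prod_inv_diff]).  With equal weights, [A] is a scalar function times
    x, and Y is the exponential of its primitive. *)

(** * Primitives of combinations of exponentials *)

Lemma continuous_expRM (R : realType) (b : R) : continuous (fun u => expR (b * u)).
Proof.
move=> u; apply: (continuous_comp (f := fun x : R => b * x) (g := expR)).
  exact: mulrl_continuous.
exact: continuous_expR.
Qed.

Lemma integral_expRNy (R : realType) (a r : R) : 0 < a ->
  (\int[@lebesgue_measure R]_(u in `]-oo, r]) (expR (a * u))%:E
   = (expR (a * r) / a)%:E)%E.
Proof.
move=> a0.
have ce := @continuous_expRM R.
have dE (x : R) : is_derive x 1 (fun u : R => - a^-1 * expR (- a * u))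
    (expR (- a * x)).
  apply: is_derive_eq; rewrite !scaler1 /GRing.scale /=.
  by field; rewrite gt_eqF.
rewrite -[r]opprK; move: (- r) => b.
rewrite ge0_integration_by_substitutionNy; first last.
- by move=> x _; exact: expR_ge0.
- by apply: continuous_subspaceT; exact: ce.
under eq_integral do rewrite /= mulrN -mulNr.
rewrite (@ge0_continuous_FTC2y _ _ (fun u => - a^-1 * expR (- a * u)) _ 0).
- by rewrite sub0e -EFinN; congr EFin; rewrite mulrN !mulNr opprK mulrC.
- by move=> x _; exact: expR_ge0.
- by apply: continuous_subspaceT; exact: ce.
- rewrite -[X in _ --> X](mulr0 (- a^-1)); apply: cvgM; first exact: cvg_cst.
  rewrite (_ : (fun x => expR (- a * x)) =
               (fun z => expR (- z)) \o (fun z => a * z)); last first.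
    by apply: eq_fun => x; rewrite mulNr.
  apply: (@cvg_comp _ _ _ _ _ _ (pinfty_nbhs R)); last exact: cvgr_expR.
  exact: gt0_cvgMry.
- by move=> x _; have [] := dE x.
- apply: cvg_at_right_filter; apply: cvgM; first exact: cvg_cst; exact: ce.
- by move=> x _; rewrite derive1E; have [_ ->] := dE x.
Qed.

Section ExpPrimitives.
Variable R : realType.
Implicit Types (s : \bar R) (F G f g : R -> R).
Notation mu := (@lebesgue_measure R).

(** The value at the starting time of the exponential of exponent [a]; the
    value 0 at -oo is the limit when a > 0. *)
Definition exp_start (s : \bar R) (a : R) : R :=
  if s is s'%:E then expR (a * s') else 0.

Lemma exp_startD s a b :
  exp_start s (a + b) = exp_start s a * exp_start s b.
Proof. by case: s => [s||] /=; rewrite ?mulr0// mulrDl expRD. Qed.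

Lemma time_int_itv s r : exists i : interval R, time_int s r = [set` i].
Proof.
case: s => [s| |].
- exists `]s, r[; apply/seteqP; split => u; rewrite /time_int/= in_itv/= lte_fin;
  by move/andP.
- by exists `]r, r[; apply/seteqP; split => u;
  rewrite /time_int/= itv_ge ?bnd_simp// => -[].
- exists `]-oo, r[; apply/seteqP; split => u; rewrite /time_int/= in_itv/= ltNyr;
  by [case|split].
Qed.

Lemma Rintegral_expR s a r : 0 < a -> (s <= r%:E)%E ->
  mu.-integrable (time_int s r) (EFin \o (fun u => expR (a * u))) /\
  (\int[mu]_(u in time_int s r) expR (a * u))%R
    = (expR (a * r) - exp_start s a) / a.
Proof.
move=> a0.
have mE : measurable_fun setT (fun u : R => expR (a * u)).
  by apply: continuous_measurable_fun; exact: continuous_expRM.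
have iE b : mu.-integrable `]-oo, b] (EFin \o (fun u => expR (a * u))).
  apply/integrableP; split.
    by apply: measurable_funTS; apply/measurable_EFinP.
  under eq_integral do rewrite /= ger0_norm ?expR_ge0//.
  by rewrite integral_expRNy// ltry.
have vE b : (\int[mu]_(u in `]-oo, b]) expR (a * u))%R = expR (a * b) / a.
  by rewrite /Rintegral integral_expRNy.
case: s => [s| |]; rewrite ?leNgt ?ltry//.
- rewrite -leNgt lee_fin => sr.
  have -> : time_int s%:E r = [set` `]s, r[].
    by apply/seteqP; split => u; rewrite /time_int/= in_itv/= lte_fin => /andP.
  split; first by apply: integrableS (iE r) => // u /=;
    rewrite !in_itv/= => /andP[_ /ltW].
  rewrite Rintegral_itv_bndo_bndc; last first.
    by apply: integrableS (iE r) => // u /=; rewrite !in_itv/= => /andP[_ /ltW].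
  by rewrite -(Rintegral_itvB (iE r)) ?bnd_simp// !vE mulrBl.
- move=> _.
  have -> : time_int -oo%E r = [set` `]-oo, r[].
    apply/seteqP; split => u; rewrite /time_int/= in_itv/=; first by case.
    by move=> ->; rewrite ltNyr.
  have iE' : mu.-integrable `]-oo, r[ (EFin \o (fun u => expR (a * u))).
    by apply: integrableS (iE r) => // u /=; rewrite !in_itv/= => /ltW.
  by split=> //; rewrite Rintegral_itv_bndo_bndc// vE subr0.
Qed.

(** A primitive vanishing at [s].  Generating the relation from exponentials
    reduces statements about products to pairs of exponentials.  Only the values
    at times at least [s] matter ([prim_eq]), since the integrals over (s, r)
    with r < s are 0 whereas the closed forms of the primitives are not. *)
Inductive primitive (s : \bar R) : (R -> R) -> (R -> R) -> Prop :=
| prim_exp a of 0 < a :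
    primitive s (fun r => (expR (a * r) - exp_start s a) / a) (fun u => expR (a * u))
| prim0 : primitive s (fun=> 0) (fun=> 0)
| primD F G f g of primitive s F f & primitive s G g :
    primitive s (fun r => F r + G r) (fun u => f u + g u)
| primZ c F f of primitive s F f : primitive s (fun r => c * F r) (fun u => c * f u)
| prim_eq F G f g of (forall r, (s <= r%:E)%E -> F r = G r)
    & (forall u, (s <= u%:E)%E -> f u = g u) & primitive s F f : primitive s G g.

Lemma prim_integral s F f r : primitive s F f -> (s <= r%:E)%E ->
  mu.-integrable (time_int s r) (EFin \o f) /\
  (\int[mu]_(u in time_int s r) f u)%R = F r.
Proof.
move=> + sr.
have mT : measurable (time_int s r) by have [i ->] := time_int_itv s r;
  exact: measurable_itv.
elim=> {F f} [a a0||F G f g _ [iF EF] _ [iG EG]|c F f _ [iF EF]|F G f g EF Ef _ [iF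
  IF]].
- exact: Rintegral_expR.
- by split; [exact: integrable0|rewrite Rintegral_cst// mul0r].
- split; first by under [X in _.-integrable _ X]funext do rewrite /= EFinD;
  exact: integrableD.
  by rewrite RintegralD// EF EG.
- split; first by under [X in _.-integrable _ X]funext do rewrite /= EFinM;
  exact: integrableZl.
  by rewrite RintegralZl// EF.
- have ee : {in time_int s r, forall u, f u = g u}.
    by move=> u; rewrite inE => -[/ltW su _]; exact: Ef.
  split; first by apply: eq_integrable iF => //= u us; rewrite ee.
  by rewrite -EF// -IF; apply: eq_Rintegral => u us; rewrite ee.
Qed.

Lemma eq_primr s F f g : (forall u, (s <= u%:E)%E -> f u = g u) ->
  primitive s F f -> primitive s F g.
Proof. by move=> e; apply: prim_eq. Qed.

Lemma prim_sum s (I : Type) (r : seq I) (P : pred I) (F f : I -> R -> R) :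
  (forall i, P i -> primitive s (F i) (f i)) ->
  primitive s (fun u => \sum_(i <- r | P i) F i u) (fun u => \sum_(i <- r | P i) f i u).
Proof.
move=> H; elim: r => [|i r IH].
  by apply: prim_eq (prim0 s) => u _; rewrite big_nil.
case Pi: (P i); last by apply: prim_eq IH => u _; rewrite big_cons Pi.
by apply: prim_eq (primD (H i Pi) IH) => u _; rewrite big_cons Pi.
Qed.

(** The boundary constant of [G] is harmless: multiplied by [f] it is again a
    combination of exponentials of positive exponents, hence integrable up to
    -oo. *)
Lemma prim_mul_ex s F f G g : primitive s F f -> primitive s G g ->
  exists H, primitive s H (fun u => f u * G u).
Proof.
elim=> {F f} [a a0||F1 F2 f1 f2 _ IH1 _ IH2|c F f _ IH|F1 F2 f1 f2 EF Ef _ IH] pg.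
- elim: pg =>
  {G g} [b b0||G1 G2 g1 g2 _ [H1 p1] _ [H2 p2]|c G g _ [H p]|G1 G2 g1 g2 EG Eg _ [H p]].
  + eexists; apply: eq_primr
      (primD (primZ b^-1 (prim_exp s (addr_gt0 a0 b0)))
             (primZ (- exp_start s b / b) (prim_exp s a0))) => u _.
    by rewrite mulrDl expRD; field; rewrite gt_eqF.
  + by eexists; apply: eq_primr (prim0 s) => u _; rewrite mulr0.
  + by eexists; apply: eq_primr (primD p1 p2) => u _; rewrite mulrDr.
  + by eexists; apply: eq_primr (primZ c p) => u _; rewrite mulrCA.
  + by eexists; apply: eq_primr p => u su; rewrite EG.
- by eexists; apply: eq_primr (prim0 s) => u _; rewrite mul0r.
- have [H1 p1] := IH1 pg; have [H2 p2] := IH2 pg.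
  by eexists; apply: eq_primr (primD p1 p2) => u _; rewrite mulrDl.
- have [H p] := IH pg.
  by eexists; apply: eq_primr (primZ c p) => u _; rewrite mulrA.
- have [H p] := IH pg.
  by eexists; apply: eq_primr p => u su; rewrite Ef.
Qed.

(** Leibniz rule.  For two exponentials of exponents a and b it reduces to
    (1/a + 1/b) / (a + b) = 1 / (a b) and to the multiplicativity of the boundary
    values ([exp_startD]). *)
Lemma primM s F f G g : primitive s F f -> primitive s G g ->
  primitive s (fun r => F r * G r) (fun u => f u * G u + F u * g u).
Proof.
elim=> {F f} [a a0||F1 F2 f1 f2 _ IH1 _ IH2|c F f _ IH|F1 F2 f1 f2 EF Ef _ IH] pg.
- elim: pg => {G g} [b b0||G1 G2 g1 g2 _ p1 _ p2|c G g _ p|G1 G2 g1 g2 EG Eg _ p].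
  + have pab := prim_exp s (addr_gt0 a0 b0).
    have pa := prim_exp s a0; have pb := prim_exp s b0.
    apply: prim_eq (primD (primZ (a^-1 + b^-1) pab)
      (primD (primZ (- exp_start s b / b) pa)
             (primZ (- exp_start s a / a) pb))) => u _;
      rewrite ?exp_startD !mulrDl !expRD; field; rewrite ?gt_eqF ?addr_gt0//.
  + by apply: prim_eq (prim0 s) => u _; rewrite !mulr0 ?addr0.
  + by apply: prim_eq (primD p1 p2) => u _; ring.
  + by apply: prim_eq (primZ c p) => u _; ring.
  + by apply: prim_eq p => u su; rewrite ?EG ?Eg.
- by apply: prim_eq (prim0 s) => u _; rewrite !mul0r ?addr0.
- by apply: prim_eq (primD (IH1 pg) (IH2 pg)) => u _; ring.
- by apply: prim_eq (primZ c (IH pg)) => u _; ring.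
- by apply: prim_eq (IH pg) => u su; rewrite ?EF ?Ef.
Qed.

Lemma primX s F f n : primitive s F f ->
  primitive s (fun r => F r ^+ n.+1) (fun u => n.+1%:R * F u ^+ n * f u).
Proof.
move=> pF; elim: n => [|n IH].
  by apply: prim_eq pF => u _; rewrite ?expr1// expr0 !mul1r.
apply: prim_eq (primM IH pF) => u _; first by rewrite -exprSr.
by rewrite -[n.+2%:R]natr1 exprSr; ring.
Qed.

Lemma ex_prim_sum s (I : Type) (r : seq I) (P : pred I) (f : I -> R -> R) :
  (forall i, P i -> exists F, primitive s F (f i)) ->
  exists F, primitive s F (fun u => \sum_(i <- r | P i) f i u).
Proof.
move=> fP; elim: r => [|i r [F IH]].
  by eexists; apply: eq_primr (prim0 s) => u _; rewrite big_nil.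
case Pi: (P i); last by exists F; apply: eq_primr IH => u _; rewrite big_cons Pi.
have [G pG] := fP i Pi.
by eexists; apply: eq_primr (primD pG IH) => u _; rewrite big_cons Pi.
Qed.

(** The exponentials with the normalization in which they enter the
    signature, where times are measured back from [t]. *)
Lemma prim_exp_shift s (a t : R) : 0 < a ->
  primitive s (fun r => (expR (- (a * (t - r))) - expR (- (a * t)) * exp_start s a) / a)
    (fun u => expR (- (a * (t - u)))).
Proof.
move=> a0; have E u : expR (- (a * (t - u))) = expR (- (a * t)) * expR (a * u).
  by rewrite -expRD; congr expR; ring.
apply: prim_eq (primZ (expR (- (a * t))) (prim_exp s a0)) => u _; rewrite E//.
by rewrite mulrA mulrBr.
Qed.

End ExpPrimitives.

(** * Identities in rings and auxiliary facts on sums *)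

(** The commutator for the opposite product, which is the convention
    of [tad]. *)
Definition adr (K : pzRingType) (w c : K) : K := c * w - w * c.

(** Write R and L for the right and left multiplications by [w], which commute,
    and D = R - L.  Both sides are (R^(k+1) - L^(k+1)) / (R - L) applied to [b],
    the right one after expanding R^(k+1) = (L + D)^(k+1).  The induction avoids
    the division: each side S_k satisfies S_(k+1) = R S_k + L^(k+1). *)
Lemma sum_pow_conj (K : pzRingType) (w b : K) k :
  \sum_(i < k.+1) w ^+ i * b * w ^+ (k - i) =
  \sum_(q < k.+1)
    (w ^+ (k - q) * iter q (adr w) b) *+ 'C(k.+1, q.+1).
Proof.
elim: k => [|k IH]; first by rewrite !big_ord1 /= !expr0 mulr1 mul1r.
rewrite big_ord_recr /= subnn expr0 mulr1.
under eq_bigr => i _ do rewrite subSn ?leq_ord// exprSr mulrA.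
rewrite -mulr_suml IH mulr_suml.
under [X in X + _ = _]eq_bigr => q _.
  rewrite mulrnAl -mulrA.
  rewrite -[X in _ * X](subrK (w * iter q (adr w) b)) -/(adr w _) -iterS.
  rewrite mulrDr mulrA -exprSr mulrnDl -subSn ?leq_ord//.
  over.
rewrite big_split /=.
rewrite [RHS](eq_bigr (fun q : 'I_k.+2 =>
   (w ^+ (k.+1 - q) * iter q (adr w) b) *+ 'C(k.+1, q.+1) +
   (w ^+ (k.+1 - q) * iter q (adr w) b) *+ 'C(k.+1, q)));
   last by move=> q _; rewrite binS mulrnDr.
rewrite [RHS]big_split /= [X in _ = X + _]big_ord_recr /= bin_small// mulr0n addr0.
rewrite [X in _ = _ + X]big_ord_recl /= subn0 bin0 mulr1n.
rewrite addrAC [RHS]addrA [RHS]addrAC [RHS]addrC -addrA [LHS]addrC -[LHS]addrA;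
  congr (_ + _).
Qed.

Lemma sum_antidiag (V : nmodType) N (f : nat -> nat -> V) :
  (forall p q, (N <= p + q)%N -> f p q = 0) ->
  \sum_(k < N) \sum_(q < k.+1) f (k - q)%N q = \sum_(p < N) \sum_(q < N) f p q.
Proof.
move=> f0; under eq_bigr => k _.
  rewrite (big_ord_widen N (fun q => f (k - q)%N q))//.
  over.
rewrite (exchange_big_dep predT)//= [RHS]exchange_big/=; apply: eq_bigr => q _.
rewrite -(big_mkord (fun k => q < k.+1)%N (fun k => f (k - q)%N q)).
rewrite (@big_cat_nat _ _ _ q)//= ?(ltnW (ltn_ord q))//.
rewrite [X in X + _]big_nat_cond big1 ?add0r; last first.
  by move=> k /andP[/andP[_ kq]]; rewrite ltnS leqNgt kq.
rewrite -{1}[nat_of_ord q]add0n big_addn.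
rewrite [LHS](eq_bigr (fun p => f p q)) => [|p _]; last by rewrite addnK.
rewrite -[RHS](big_mkord xpredT (fun p => f p q)).
rewrite [RHS](@big_cat_nat _ _ _ (N - q))//= ?leq_subr//.
rewrite [X in _ + X]big_nat_cond [X in _ + X]big1 ?addr0; last first.
  by move=> p /andP[/andP[pN _] _]; apply: f0; rewrite -leq_subLR leq_subCl.
rewrite [LHS]big_nat_cond [RHS]big_nat_cond; apply: eq_bigl => p.
by rewrite !andbT ltnS leq_addl/= ltn_subRL addnC andbT.
Qed.

(** The product of the series z / (e^z - 1) and (e^z - 1) / z is 1. *)
Lemma bernoulli_convol (R : realType) n :
  \sum_(m < n.+1) bernoulli R m / m`!%:R * ((n - m).+1)`!%:R^-1 = (n == 0)%:R.
Proof.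
rewrite -[RHS](bernoulli_genfun R n.+1)
  [RHS]big_ord_recr /= subnn ltnn mul0r mulr0 addr0.
by apply: eq_bigr => m _; rewrite subSn ?leq_ord// ltn0Sn mul1r.
Qed.

Lemma big_tuple_cons (V : nmodType) (T : finType) j (F : seq T -> V) :
  \sum_(k : j.+1.-tuple T) F k = \sum_(x : T) \sum_(k : j.-tuple T) F (x :: k).
Proof.
rewrite pair_bigA /= (reindex (fun p : T * j.-tuple T => [tuple of p.1 :: p.2]))//=.
exists (fun k : j.+1.-tuple T => (thead k, [tuple of behead k])) => [[x k]|k] _ /=.
  by congr pair; apply: val_inj.
by rewrite -tuple_eta.
Qed.

(** Multilinear expansion; a tuple lists the summands from the outermost
    commutator to the innermost one. *)
Lemma iter_adr_sum (K : pzRingType) n (m : nat -> K) (a : K) j :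
  iter j (adr (\sum_(k < n) m k)) a =
  \sum_(k : j.-tuple 'I_n) foldr (fun (i : 'I_n) b => adr (m i) b) a k.
Proof.
elim: j => [|j IH].
  rewrite (big_pred1 [tuple]) // => k; apply/esym/eqP; exact: tuple0.
rewrite iterS IH (big_tuple_cons j (foldr (fun (i : 'I_n) b => adr (m i) b) a)).
rewrite /adr mulr_suml mulr_sumr -sumrB exchange_big /=; apply: eq_bigr => k _.
by rewrite mulr_sumr mulr_suml -sumrB.
Qed.

Lemma inv_fact_bin (R : numFieldType) n m : (m <= n)%N ->
  n`!%:R^-1 * 'C(n, m)%:R = (n - m)`!%:R^-1 * m`!%:R^-1 :> R.
Proof.
move=> mn; have nz k : (k`!%:R : R) != 0 by rewrite pnatr_eq0 -lt0n fact_gt0.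
apply: (mulfI (nz n)); rewrite mulrA mulfV// mul1r -(bin_fact mn) !natrM.
have a := nz m; have b := nz (n - m)%N.
by field; rewrite a b.
Qed.

Lemma cvg_series_eventually0 (R : realType) (f : nat -> R) N :
  (forall k, (N <= k)%N -> f k = 0) ->
  series f n @[n --> \oo] --> \sum_(k < N) f k.
Proof.
move=> f0; apply: cvg_near_cst; near=> n.
have Nn : (N <= n)%N by near: n; exact: nbhs_infty_ge.
rewrite /series /= (@big_cat_nat _ _ _ N)//= big_mkord [X in _ + X]big_nat_cond.
by rewrite [X in _ + X]big1 ?addr0// => k /andP[/andP[/f0]].
Unshelve. all: by end_near. Qed.

Lemma take_rcons_all (T : Type) (w : seq T) i : take (size w).+1 (rcons w i)
  = rcons w i.
Proof. by rewrite -(size_rcons w i) take_size. Qed.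

Lemma prod_rcons (R : pzSemiRingType) (T : Type) (w : seq T) i (F : T -> R) :
  \prod_(j <- rcons w i) F j = (\prod_(j <- w) F j) * F i.
Proof. by rewrite -cats1 big_cat big_seq1. Qed.

(** * The ring of noncommutative series *)

(** A copy of [tens] for the ring structure whose product is [tmul]: functions
    into R already carry the pointwise product. *)
Definition ncseries (R : realType) (d : nat) := tens R d.
HB.instance Definition _ R d := GRing.Zmodule.copy (ncseries R d) (word d -> R).

Section NcSeries.
Variables (R : realType) (d : nat).
Implicit Types (p q r w : tens R d) (v : word d).

Lemma tmul_nil p q : tmul p q [::] = p [::] * q [::].
Proof. by rewrite /tmul big_ord1. Qed.

Lemma tmul_cons p q i v :
  tmul p q (i :: v) = p [::] * q (i :: v) + tmul (fun u => p (i :: u)) q v.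
Proof. by rewrite /tmul big_ord_recl. Qed.

Lemma tmul1l p : tmul (@tone R d) p = p.
Proof.
apply/funext => v; rewrite /tmul big_ord_recl take0 drop0 /tone eqxx mul1r.
rewrite big1 ?addr0// => k _.
by case: v k => [[]//|i v] k; rewrite /= mul0r.
Qed.

Lemma tmul1r p : tmul p (@tone R d) = p.
Proof.
apply/funext => v; rewrite /tmul big_ord_recr /= drop_size take_size /tone eqxx mulr1.
rewrite big1 ?add0r// => k _.
by rewrite -size_eq0 size_drop subn_eq0 leqNgt ltn_ord mulr0.
Qed.

Lemma tensDE p q v : (p + q) v = p v + q v.
Proof. by []. Qed.

Lemma tmulDl p q r : tmul (p + q) r = tmul p r + tmul q r.
Proof.
apply/funext => v; rewrite /tmul tensDE -big_split.
by apply: eq_bigr => k _; rewrite tensDE mulrDl.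
Qed.

Lemma tmulDr p q r : tmul r (p + q) = tmul r p + tmul r q.
Proof.
apply/funext => v; rewrite /tmul tensDE -big_split.
by apply: eq_bigr => k _; rewrite tensDE mulrDr.
Qed.

Lemma tmulZl a p q : tmul (tscale a p) q = tscale a (tmul p q).
Proof.
by apply/funext => v; rewrite /tscale /tmul mulr_sumr; apply: eq_bigr => k _;
  rewrite mulrA.
Qed.

Lemma tmulZr a p q : tmul p (tscale a q) = tscale a (tmul p q).
Proof.
by apply/funext => v; rewrite /tscale /tmul mulr_sumr; apply: eq_bigr => k _;
  rewrite mulrCA.
Qed.

Lemma tmulA : associative (@tmul R d).
Proof.
move=> p q r; apply/funext => v; elim: v p => [|i v IH] p.
  by rewrite !tmul_nil mulrA.
rewrite !tmul_cons tmul_nil IH mulrDr mulrA -addrA; congr (_ + _).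
rewrite (_ : (fun u => tmul p q (i :: u)) =
   tscale (p [::]) (fun u => q (i :: u)) + tmul (fun u => p (i :: u)) q).
  by rewrite tmulDl tmulZl.
by apply/funext => u; rewrite tmul_cons.
Qed.

End NcSeries.

HB.instance Definition _ R d := GRing.Zmodule_isPzRing.Build (ncseries R d)
  (@tmulA R d) (@tmul1l R d) (@tmul1r R d) (fun p q r => tmulDl p q r)
  (fun p q r => tmulDr q r p).

Section Levels.
Variables (R : realType) (d : nat).
Implicit Types (p q r w : ncseries R d) (v : word d) (P Q S : pred nat).

Lemma tpowE p k : tpow p k = p ^+ k.
Proof. by elim: k => // k IH; rewrite exprS -IH. Qed.

Lemma tens_sumE (I : Type) (r : seq I) (P : pred I) (F : I -> tens R d) v :
  (\sum_(i <- r | P i) F i) v = \sum_(i <- r | P i) F i v.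
Proof. by apply: (big_morph (fun p : tens R d => p v)). Qed.

Lemma tens_mulrnE p n v : (p *+ n) v = p v *+ n.
Proof. by elim: n => // n IH; rewrite !mulrS -IH. Qed.

Lemma adr_sum w (I : Type) (r : seq I) (P : pred I) (c : I -> R) (F : I -> tens R d) :
  adr w (\sum_(i <- r | P i) tscale (c i) (F i)) =
  \sum_(i <- r | P i) tscale (c i) (adr w (F i)).
Proof.
rewrite /adr mulr_suml mulr_sumr -sumrB; apply: eq_bigr => i _.
rewrite [LHS](_ : _ = tmul (tscale (c i) (F i)) w - tmul w (tscale (c i) (F i)))//.
by rewrite tmulZl tmulZr; apply/funext => v; rewrite /tscale !fctE mulrBr.
Qed.

(** The series whose nonzero coefficients sit on words of length in [P]:
    homogeneous series of degree n for [pred1 n], series without terms of degree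
    less than n for [leq n].  With the latter, [p - q] expresses equality up to
    truncation. *)
Definition level_in P p := forall v, ~~ P (size v) -> p v = 0.

Lemma level_inW P Q p : (forall n, P n -> Q n) -> level_in P p -> level_in Q p.
Proof. by move=> PQ Pp v Qv; apply: Pp; apply: contra Qv => /PQ. Qed.

Lemma level_in_pos p : p [::] = 0 -> level_in (leq 1) p.
Proof. by move=> p0 [|]. Qed.

Lemma level_inM P Q S p q : (forall m n, P m -> Q n -> S (m + n)%N) ->
  level_in P p -> level_in Q q -> level_in S (p * q).
Proof.
move=> PQS Pp Qq v; apply: contraNeq => pqv.
have [k] : exists k : 'I_(size v).+1, p (take k v) * q (drop k v) != 0.
  apply/existsP; apply: contraNT pqv; rewrite negb_exists => /forallP h.
  by apply/eqP; apply: big1 => k _; have := h k; rewrite negbK => /eqP.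
rewrite mulf_eq0 negb_or => /andP[pk qk].
rewrite -[v in S (size v)](cat_take_drop k) size_cat; apply: PQS.
  by apply: contraNT pk => /Pp ->.
by apply: contraNT qk => /Qq ->.
Qed.

Lemma level_inB P p q : level_in P p -> level_in P q -> level_in P (p - q).
Proof.
by move=> Pp Pq v Pv; rewrite [LHS](_ : _ = p v - q v)// Pp// Pq// subr0.
Qed.

Lemma level_inD P p q : level_in P p -> level_in P q -> level_in P (p + q).
Proof. by move=> Pp Pq v Pv; rewrite [LHS](_ : _ = p v + q v)// Pp// Pq// addr0. Qed.

Lemma level_in_ad P Q S p q : (forall m n, P m -> Q n -> S (m + n)%N) ->
  level_in P p -> level_in Q q -> level_in S (adr p q).
Proof.
move=> PQS Pp Qq; apply: level_inB; last exact: level_inM Pp Qq.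
by apply: level_inM Qq Pp => m n Qm Pn; rewrite addnC; exact: PQS.
Qed.

Lemma level_inX p k : p [::] = 0 -> level_in (leq k) (p ^+ k).
Proof.
move=> p0; elim: k => [|k IH]; first by [].
rewrite exprS; apply: (@level_inM (leq 1) (leq k)) IH => [m n|];
  last exact: level_in_pos.
by rewrite -[k.+1]add1n; apply: leq_add.
Qed.

Lemma level_in_iter_ad w p k n : w [::] = 0 -> level_in (leq n) p ->
  level_in (leq (k + n)) (iter k (adr w) p).
Proof.
move=> w0 pn; elim: k => [//|k IH]; rewrite iterS.
apply: (@level_in_ad (leq 1) (leq (k + n))) IH => [m l|]; last exact: level_in_pos.
by rewrite addSn -[(k + n).+1]add1n; apply: leq_add.
Qed.

(** As [p] has no constant term, truncating [w] to degrees less than [n] affects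
    the iterated commutators only in degrees greater than [n]; this
    is what makes the Magnus recursion well founded. *)
Lemma level_in_iter_ad_trunc w w' p k n : w [::] = 0 -> w' [::] = 0 ->
  level_in (leq n) (w - w') -> p [::] = 0 ->
  level_in (leq n.+1) (iter k (adr w) p - iter k (adr w') p).
Proof.
move=> w0 w'0 ww' p0; elim: k => [|k IH]; first by rewrite subrr.
rewrite !iterS.
set c := iter k (adr w) p in IH *; set c' := iter k (adr w') p in IH *.
have -> : adr w c - adr w' c' = adr (w - w') c + adr w' (c - c').
  rewrite !/adr !(mulrBl, mulrBr) [in RHS]addrACA subrKA.
  by rewrite -opprD subrKA !opprB addrACA [in RHS]addrACA [in RHS](addrC (- (c' * w'))).
apply: level_inD.
  apply: (@level_in_ad (leq n) (leq 1)) ww' _ => [m l|]; last first.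
    apply: level_inW (@level_in_iter_ad w p k 1 w0 (level_in_pos p0)) => m;
      rewrite addn1.
    exact: leq_ltn_trans.
  by rewrite -[n.+1]addn1; apply: leq_add.
apply: (@level_in_ad (leq 1) (leq n.+1)) IH => [m l|]; last exact: level_in_pos.
by move=> m0 nl; rewrite -[n.+1]add0n leq_add.
Qed.

Lemma level_inZ P a (p : ncseries R d) : level_in P p -> level_in P (tscale a p).
Proof. by move=> Pp v Pv; rewrite /tscale Pp// mulr0. Qed.

Lemma level_in_sum P (I : Type) (r : seq I) (Q : pred I) (F : I -> ncseries R d) :
  (forall i, Q i -> level_in P (F i)) -> level_in P (\sum_(i <- r | Q i) F i).
Proof. by move=> FP v Pv; rewrite tens_sumE big1// => i /FP ->. Qed.

Lemma tmul_rcons_level1 (p a : ncseries R d) (u : word d) i : level_in (pred1 1%N) a ->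
  tmul p a (rcons u i) = p u * a [:: i].
Proof.
move=> a1; rewrite /tmul size_rcons big_ord_recr/= big_ord_recr/=.
have -> : drop (size u).+1 (rcons u i) = [::] by rewrite -(size_rcons u i) drop_size.
rewrite [a [::]]a1// mulr0 addr0.
rewrite -cats1 take_size_cat// drop_size_cat// big1 ?add0r// => k _.
rewrite [a _]a1 ?mulr0//= size_drop size_cat addn1.
by rewrite subSn ?(ltnW (ltn_ord k))// eqSS subn_eq0 -ltnNge.
Qed.

End Levels.

(** * The derivative of the exponential *)

Section ExpDerivative.
Variables (R : realType) (d : nat).
Implicit Types (p q w a : ncseries R d) (v : word d).

Lemma texp_trunc p v N : p [::] = 0 -> (size v < N)%N ->
  texp p v = \sum_(k < N) k`!%:R^-1 * (p ^+ k) v.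
Proof.
move=> p0 vN; apply: cvg_lim => //.
under [X in _ --> X]eq_bigr => k _ do rewrite -tpowE.
apply: (@cvg_series_eventually0 _ (fun k => k`!%:R^-1 * tpow p k v)) => k Nk.
by rewrite tpowE (level_inX p0) ?mulr0// -ltnNge (leq_trans vN).
Qed.

Lemma texp_nil (p : ncseries R d) : p [::] = 0 -> texp p [::] = 1.
Proof. by move=> p0; rewrite (texp_trunc (N := 1) p0)// big_ord1 fact0 invr1 mul1r. Qed.

(** The series sum_j B_j / j! ad_w^j a, that is ad_w / (e^(ad_w) - 1) applied to
    [a].  Since ad_w^j a starts in degree j + 1 when [w] and [a] have no constant
    term, the sum stops at the length of the word. *)
Definition dexp_inv w a : tens R d :=
  fun v => \sum_(j < size v) bernoulli R j / j`!%:R * iter j (tad w) a v.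

Lemma dexp_inv_trunc w a N : w [::] = 0 -> a [::] = 0 ->
  level_in (leq N.+1) ((dexp_inv w a : ncseries R d) -
    \sum_(m < N) tscale (bernoulli R m / m`!%:R) (iter m (adr w) a)).
Proof.
move=> w0 a0 v; rewrite -ltnNge ltnS => vN.
rewrite [LHS](_ : _ = dexp_inv w a v -
   (\sum_(m < N) tscale (bernoulli R m / m`!%:R) (iter m (adr w) a)) v)//.
rewrite tens_sumE /dexp_inv (big_ord_widen N
  (fun j => bernoulli R j / j`!%:R * iter j (tad w) a v))//.
rewrite big_mkcond -sumrB big1// => m _; case: ltnP => vm; first exact: subrr.
rewrite /tscale (@level_in_iter_ad _ _ w a m 1 w0 (level_in_pos a0)) ?mulr0 ?subrr//.
by rewrite addn1 -ltnNge ltnS.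
Qed.

(** The left-hand side is the coefficient of the derivative of exp w in the
    direction [dexp_inv w a].  Expanding it in the series w^p ad_w^n a gives
    the coefficient of w^p ad_w^n a as 1/p! times the convolution of
    [bernoulli_convol], so that only n = 0 survives. *)
Lemma dexp_dexp_inv w a v : w [::] = 0 -> a [::] = 0 ->
  \sum_(k < size v) (k.+1)`!%:R^-1 *
    (\sum_(i < k.+1) w ^+ i * (dexp_inv w a : ncseries R d) * w ^+ (k - i)) v
  = tmul (texp w) a v.
Proof.
move=> w0 a0; set N := size v.
pose c m : R := bernoulli R m / m`!%:R.
pose t (p n : nat) := (w ^+ p * iter n (adr w) a) v.
have t0 (p n : nat) : (N <= p + n)%N -> t p n = 0.
  move=> Npn; rewrite /t.
  have := @level_inM _ _ (leq p) (leq (n + 1)) (leq (p + (n + 1))) (w ^+ p)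
    (iter n (adr w) a).
  apply; first by move=> *; exact: leq_add.
  - exact: level_inX.
  - by apply: level_in_iter_ad => //; exact: level_in_pos.
  - by rewrite addnA addn1 -ltnNge ltnS.
(* On words of length at most N, dexp_inv may be replaced by the sum b with a
   fixed number of terms, to which the commutators apply term by term. *)
pose b : ncseries R d := \sum_(m < N) tscale (c m) (iter m (adr w) a).
have nz k : (k`!%:R : R) != 0 by rewrite pnatr_eq0 -lt0n fact_gt0.
have E1 k : (\sum_(i < k.+1) w ^+ i * (dexp_inv w a : ncseries R d) * w ^+ (k - i)) v
    = (\sum_(i < k.+1) w ^+ i * b * w ^+ (k - i)) v.
  apply/eqP; rewrite -subr_eq0 -[X in X == _]/((_ - _ : ncseries R d) v)
    -sumrB tens_sumE.
  apply/eqP; apply: big1 => i _; rewrite -mulrBl -mulrBr.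
  have wl := dexp_inv_trunc (N := N) w0 a0.
  have h : level_in (leq N.+1) (w ^+ i * ((dexp_inv w a : ncseries R d) - b)).
    apply: level_inM (level_inX (k := i) w0) wl => m n _ Nn.
    exact: leq_trans Nn (leq_addl _ _).
  apply: (level_inM (P := leq N.+1) (Q := leq 0) (S := leq N.+1)) h _ _ _ => //.
    by move=> m n Nm _; exact: leq_trans Nm (leq_addr _ _).
  by rewrite -ltnNge.
have E2 (q : nat) : iter q (adr w) b = \sum_(m < N) tscale (c m) (iter (q + m) (adr w)
  a).
  by elim: q => [//|q IH]; rewrite iterS IH adr_sum.
have E3 (p q : nat) : (w ^+ p * iter q (adr w) b) v = \sum_(m < N) c m * t p (q + m)%N.
  rewrite E2 mulr_sumr tens_sumE; apply: eq_bigr => m _.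
  by rewrite -[LHS]/(tmul _ _ v) tmulZr.
pose g (p q : nat) := p`!%:R^-1 * \sum_(m < N) (q.+1)`!%:R^-1 * c m * t p (q + m)%N.
transitivity (\sum_(k < N) \sum_(q < k.+1) g (k - q)%N q).
  apply: eq_bigr => k _; rewrite E1 (sum_pow_conj w b k) tens_sumE mulr_sumr.
  apply: eq_bigr => q _; rewrite tens_mulrnE E3 /g.
  rewrite -[X in _ * X = _]mulr_natl !mulr_sumr; apply: eq_bigr => m _.
  have qk : (q.+1 <= k.+1)%N by [].
  by rewrite [LHS]mulrA (inv_fact_bin R qk) subSS !mulrA.
(* All terms with p + q >= N vanish, so the triangle k = p + q < N may be
   replaced by a square, and the sum over p then separates. *)
rewrite sum_antidiag; last first.
  move=> p q Npq; rewrite /g big1 ?mulr0// => m _.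
  by rewrite t0 ?mulr0// addnA (leq_trans Npq)// leq_addr.
have E4 (p : nat) : (0 < N)%N -> \sum_(q < N) g p q = p`!%:R^-1 * t p 0.
  move=> N0; rewrite -mulr_sumr; congr (_ * _).
  rewrite -(@sum_antidiag _ N (fun q m : nat => (q.+1)`!%:R^-1 * c m * t p (q + m)%N));
    last first.
    by move=> q m Nqm; rewrite t0 ?mulr0// (leq_trans Nqm)// leq_addl.
  under eq_bigr => n _.
    rewrite (eq_bigr (fun m : 'I_n.+1 => c m * ((n - m).+1)`!%:R^-1 * t p n));
      last first.
      by move=> m _; rewrite subnK ?leq_ord// [c m * _]mulrC.
    rewrite -mulr_suml bernoulli_convol.
    over.
  rewrite -(prednK N0) big_ord_recl /= mul1r big1 ?addr0// => n _.
  by rewrite /= mul0r.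
rewrite (eq_bigr (fun p : 'I_N => p`!%:R^-1 * t p 0%N)); last first.
  by move=> p _; apply: E4; exact: leq_ltn_trans (ltn_ord p).
(* As a has no constant term, only the coefficients of exp w on words shorter
   than N count. *)
pose e : ncseries R d := \sum_(p < N) tscale p`!%:R^-1 (w ^+ p).
have -> : tmul (texp w) a v = tmul e a v.
  apply/eqP; rewrite -subr_eq0.
  rewrite -[X in X == _]/(((texp w : ncseries R d) * a - e * a) v) -mulrBl; apply/eqP.
  apply: (level_inM (P := leq N) (Q := leq 1) (S := leq N.+1)).
  - by rewrite -[N.+1]addn1; exact: leq_add.
  - move=> u; rewrite -ltnNge => uN.
    rewrite [LHS](_ : _ = texp w u - e u)// (texp_trunc w0 uN) /e tens_sumE.
    exact: subrr.
  - exact: level_in_pos.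
  - by rewrite -ltnNge.
rewrite -[RHS]/((e * a) v) mulr_suml tens_sumE; apply: eq_bigr => p _.
by rewrite -[RHS]/(tmul _ _ v) tmulZl.
Qed.

Lemma expr_tvec (y : 'rV[R]_d) k (v : word d) :
  ((tvec y : ncseries R d) ^+ k) v = (size v == k)%:R * \prod_(i <- v) y 0 i.
Proof.
elim: k v => [|k IH] v.
  rewrite expr0 -[LHS]/((v == [::])%:R : R) size_eq0.
  by case: eqP => [->|]; rewrite ?big_nil ?mulr1// mul0r.
elim/last_ind: v => [|w i _]; first by rewrite exprSr [LHS]tmul_nil mulr0 mul0r.
rewrite exprSr [LHS]tmul_rcons_level1; last by case=> [|? [|]].
by rewrite IH size_rcons eqSS prod_rcons mulrA.
Qed.

Lemma texp_tvec (y : 'rV[R]_d) (v : word d) :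
  texp (tvec y) v = (size v)`!%:R^-1 * \prod_(i <- v) y 0 i.
Proof.
rewrite (texp_trunc (p := tvec y) (erefl 0) (ltnSn (size v)))
  big_ord_recr /= big1 ?add0r => [|k _].
  by rewrite expr_tvec eqxx mul1r.
by rewrite expr_tvec gtn_eqF// mul0r mulr0.
Qed.

End ExpDerivative.

(** * Primitives of families of series *)

Section TensorPrimitives.
Variables (R : realType) (d : nat).
Implicit Types (s : \bar R) (v : word d) (U V W : R -> ncseries R d).

Definition tprimitive s U U' := forall v, primitive s (U ^~ v) (U' ^~ v).

Lemma tprimM s U U' V V' : tprimitive s U U' -> tprimitive s V V' ->
  tprimitive s (fun r => U r * V r) (fun u => U' u * V u + U u * V' u).
Proof.
move=> pU pV v.
have := @prim_sum R s _ (index_enum 'I_(size v).+1) predT _ _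
  (fun k _ => primM (pU (take k v)) (pV (drop k v))).
by apply: prim_eq => u _ //; rewrite big_split.
Qed.

Lemma tprimX s W W' k : tprimitive s W W' ->
  tprimitive s (fun r => W r ^+ k.+1)
    (fun u => \sum_(i < k.+1) W u ^+ i * W' u * W u ^+ (k - i)).
Proof.
move=> pW; elim: k => [|k IH] v.
  by apply: prim_eq (pW v) => u _; rewrite ?expr1// big_ord1 /= mul1r mulr1.
apply: prim_eq (tprimM IH pW v) => u _; first by rewrite -exprSr.
rewrite [in RHS]big_ord_recr /= subnn expr0 mulr1 mulr_suml.
congr ((_ + _ : ncseries R d) v); apply: eq_bigr => i _.
by rewrite subSn ?leq_ord// exprSr mulrA.
Qed.

Lemma prim_texp s W A v : (forall u, W u [::] = 0) -> (forall u, A u [::] = 0) ->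
  tprimitive s W (fun u => dexp_inv (W u) (A u)) -> v != [::] ->
  primitive s (fun r => texp (W r) v) (fun u => tmul (texp (W u)) (A u) v).
Proof.
move=> W0 A0 pW v0.
have := @prim_sum R s _ (index_enum 'I_(size v)) predT _ _
  (fun k _ => primZ (k.+1)`!%:R^-1 (tprimX k pW v)).
apply: prim_eq => u _; last exact: dexp_dexp_inv.
rewrite (texp_trunc (W0 u) (ltnSn (size v))) big_ord_recl /=.
by rewrite expr0 -[(1 : ncseries R d) v]/((v == [::])%:R : R) (negbTE v0) mulr0 add0r.
Qed.

(** The integral equations determine the coefficients by induction on the
    word, the last letter being the outermost integration variable. *)
Lemma efm_iterE (lambda x : 'rV[R]_d) s t (Y : R -> tens R d) :
  (forall r, Y r [::] = 1) ->
  (forall w i, primitive s (fun r => Y r (rcons w i))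
     (fun u => Y u w * (expR (- (lambda 0 i * (t - u))) * x 0 i))) ->
  forall v r, (s <= r%:E)%E ->
    efm_iter lambda (fun u => u *: x) s t (rev v) r = Y r v.
Proof.
move=> Y0 pY; elim/last_ind => [|w i IH] r sr; first by rewrite Y0.
rewrite rev_rcons /= -(prim_integral (pY w i) sr).2.
apply: eq_Rintegral => u; rewrite inE => -[/ltW su _].
rewrite IH// -mulrA; congr (_ * (_ * _)).
under [X in derive1 X]funext do rewrite mxE.
rewrite derive1E; apply: derive_val.
by apply: is_derive_eq; rewrite scaler0 add0r; exact: mulr1.
Qed.

End TensorPrimitives.

(** * Magnus terms *)

Section MagnusTerms.
Variables (R : realType) (d : nat) (s : \bar R) (A : R -> ncseries R d).
Hypothesis A_level1 : forall u, level_in (pred1 1%N) (A u).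
Hypothesis A_prim : forall v, exists F, primitive s F (A ^~ v).
Implicit Types (v : word d).
Local Notation Om := (magnus s A).

Lemma level_in_foldr_ad n (m : nat -> ncseries R d) (a : ncseries R d) (k : seq 'I_n) :
  (forall i, (i < n)%N -> level_in (pred1 i) (m i)) -> level_in (pred1 1%N) a ->
  level_in (pred1 (\sum_(i <- k) i).+1)
    (foldr (fun (i : 'I_n) (B : tens R d) => tad (m i) B) a k).
Proof.
move=> ml al; elim: k => [|i k IH] /=; first by rewrite big_nil.
apply: (level_in_ad _ (ml i (ltn_ord i)) IH) => p q /eqP -> /eqP ->.
by rewrite /= big_cons addnS eqxx.
Qed.

Lemma level_in_tint P (F : R -> ncseries R d) r : (forall u, level_in P (F u)) ->
  level_in P (tint s r F).
Proof.
move=> FP v Pv; rewrite /tint; under eq_Rintegral do rewrite FP//.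
by have [i ->] := time_int_itv s r; rewrite Rintegral_cst// mul0r.
Qed.

(** The entries of the compositions in the recursion add up to n - 1, and the
    innermost factor [A] contributes one more letter. *)
Lemma magnus_level n r : level_in (pred1 n) (Om n r).
Proof.
elim/ltn_ind: n r => -[//|[|n]] IH r; first by rewrite magnus1; exact: level_in_tint.
rewrite magnusE//; apply: level_in_sum => j _; apply: level_inZ; apply: level_in_sum.
move=> k /andP[_ /eqP kn]; apply: level_in_tint => u.
have := @level_in_foldr_ad n.+2 (fun i => Om i u) (A u) k (fun i ik => IH i ik u)
  (A_level1 u).
by rewrite kn.
Qed.

Lemma prim_tint (F : R -> tens R d) v : (exists G, primitive s G (fun u => F u v)) ->
  primitive s (fun r => tint s r F v) (fun u => F u v).
Proof.
by move=> [G pG]; apply: prim_eq (pG) => // r sr; rewrite -(prim_integral pG sr).2.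
Qed.

Definition magnus_integrand n u : tens R d :=
  \sum_(1 <= j < n)
    tscale (bernoulli R j / j`!%:R)
      (\sum_(k : j.-tuple 'I_n | all (fun ki : 'I_n => 0 < ki)%N k
                                 && (\sum_(ki <- k) ki == n.-1)%N)
        foldr (fun (ki : 'I_n) (B : tens R d) => tad (Om ki u) B) (A u) k).

(** Integrability of the integrands of the recursion: the innermost factor [A]
    provides exponentials of positive exponent, which products with Magnus terms
    preserve. *)
Lemma ex_prim_foldr_ad n (m : nat -> R -> ncseries R d) m' (k : seq 'I_n) v :
  (forall i, (i < n)%N -> tprimitive s (m i) (m' i)) ->
  exists F, primitive s F (fun u =>
    foldr (fun (i : 'I_n) (B : tens R d) => tad (m i u) B) (A u) k v).
Proof.
move=> mp; elim: k v => [//|i k IH] v /=.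
pose B u := foldr (fun (i : 'I_n) (B : tens R d) => tad (m i u) B) (A u) k.
have [F1 p1] : exists F, primitive s F (fun u => tmul (B u) (m i u) v).
  apply: ex_prim_sum => l _; have [F pF] := IH (take l v).
  exact: prim_mul_ex pF (mp i (ltn_ord i) _).
have [F2 p2] : exists F, primitive s F (fun u => tmul (m i u) (B u) v).
  apply: ex_prim_sum => l _; have [F pF] := IH (drop l v).
  have [H pH] := prim_mul_ex pF (mp i (ltn_ord i) (take l v)).
  by exists H; apply: eq_primr pH => u _; rewrite mulrC.
eexists; apply: eq_primr (primD p1 (primZ (-1) p2)) => u _.
by rewrite mulN1r.
Qed.

(** The right-hand side of the recursion is a linear combination of integrals, of
    functions that [ex_prim_foldr_ad] shows to be integrable. *)
Lemma magnus_prim n : (1 < n)%N ->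
  (forall k, (0 < k < n)%N -> exists W', tprimitive s (Om k) W') ->
  tprimitive s (Om n) (magnus_integrand n).
Proof.
move=> n1 IH v.
have /choice[m' mP] i : exists W', (i < n)%N -> tprimitive s (Om i) W'.
  case: i => [|i].
    by exists (fun=> 0) => _ w; exact: prim0.
  case: (ltnP i.+1 n) => [ik|_]; last by exists (fun=> 0).
  by have [W' pW] := IH i.+1 ik; exists W'.
have := @prim_sum R s _ (index_iota 1 n) predT _ _ (fun j _ =>
  primZ (bernoulli R j / j`!%:R) (@prim_sum R s _ (index_enum (j.-tuple 'I_n))
    (fun k : j.-tuple 'I_n => all (fun ki : 'I_n => 0 < ki)%N k
              && (\sum_(ki <- k) ki == n.-1)%N) _ _
    (fun k _ => @prim_tint (fun u =>
      foldr (fun (ki : 'I_n) (B : tens R d) => tad (Om ki u) B) (A u) k)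
        v (ex_prim_foldr_ad k v mP)))).
apply: prim_eq => u _.
  rewrite magnusE// /magnus_rhs tens_sumE; apply: eq_bigr => j _.
  by rewrite /tscale tens_sumE.
rewrite /magnus_integrand tens_sumE; apply: eq_bigr => j _.
by rewrite /tscale tens_sumE.
Qed.

(** The sum of all Magnus terms: by homogeneity the only term that
    contributes to a word is the one indexed by its length. *)
Definition magnus_sum r : ncseries R d := fun v => Om (size v) r v.

Lemma magnus_sum_trunc n r :
  level_in (leq n) (magnus_sum r - \sum_(k < n) (Om k r : ncseries R d)).
Proof.
move=> v; rewrite -ltnNge => vn.
rewrite -[LHS]/(magnus_sum r v - (\sum_(k < n) (Om k r : ncseries R d)) v).
rewrite tens_sumE (bigD1 (Ordinal vn)) //= big1 ?addr0 ?subrr// => k kv.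
by rewrite magnus_level//=; apply: contra kv => /eqP e; apply/eqP/val_inj.
Qed.

(** The iterated commutators of the sum of the Magnus terms expand over all
    tuples of indices.  On a word of length n, tuples of sum other than n - 1 are
    discarded by homogeneity, and those with an entry 0 because the term of index
    0 vanishes; what remains is the sum over compositions. *)
Lemma dexp_inv_magnus_sum u v : (1 < size v)%N ->
  magnus_integrand (size v) u v = dexp_inv (magnus_sum u) (A u) v.
Proof.
set n := size v => n1; rewrite /magnus_integrand tens_sumE /dexp_inv -/n.
rewrite -[RHS](big_mkord predT (fun j =>
  bernoulli R j / j`!%:R * iter j (tad (magnus_sum u)) (A u) v)).
rewrite [RHS]big_ltn ?(ltnW n1)// [iter 0 _ (A u)]/= [A u v]A_level1 ?mulr0 ?add0r;
  last first.
  by rewrite /= -/n gtn_eqF.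
apply: eq_bigr => j _; rewrite /tscale; congr (_ * _).
have -> : iter j (tad (magnus_sum u)) (A u) v =
          iter j (adr (\sum_(k < n) (Om k u : ncseries R d))) (A u) v.
  apply/eqP; rewrite -subr_eq0; apply/eqP.
  have A0 : A u [::] = 0 by exact: A_level1.
  have := @level_in_iter_ad_trunc _ _ (magnus_sum u)
    (\sum_(k < n) (Om k u : ncseries R d)) (A u) j n _ _ (magnus_sum_trunc (n := n) u)
      A0.
  apply => //; last by rewrite -ltnNge.
  rewrite tens_sumE big1// => k _; have [->//|k0] := posnP k.
  by rewrite magnus_level//= eq_sym -lt0n.
rewrite (@iter_adr_sum (ncseries R d) n (fun k => Om k u)) !tens_sumE.
rewrite [RHS](bigID (fun k : j.-tuple 'I_n => all (fun ki : 'I_n => 0 < ki)%N k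
              && (\sum_(ki <- k) ki == n.-1)%N)) /=.
rewrite [X in _ = _ + X]big1 ?addr0// => k; rewrite negb_and => /orP[|kn]; last first.
  have := @level_in_foldr_ad n (fun i => Om i u) (A u) k (fun i _ => @magnus_level i u)
    (A_level1 u).
  apply; rewrite /= -/n; apply: contra kn => /eqP e.
  by apply/eqP; exact: esym (congr1 predn e).
rewrite -has_predC => k0.
suff -> : foldr (fun (i : 'I_n) b => adr (Om i u : ncseries R d) b) (A u) k = 0 by [].
elim: (tval k) k0 => //= i l IH /orP[|/IH ->]; last by rewrite /adr mul0r mulr0 subrr.
rewrite lt0n negbK => /eqP ->; rewrite /adr -[magnus _ _ 0 u]/(0 : ncseries R d).
by rewrite mul0r mulr0 subrr.
Qed.

Lemma magnus_sum_prim : tprimitive s magnus_sum (fun u => dexp_inv (magnus_sum u)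
  (A u)).
Proof.
have Om1 : tprimitive s (Om 1) A by move=> v; apply: prim_tint.
have ex n : exists W', tprimitive s (Om n.+1) W'.
  elim/ltn_ind: n => -[|n] IH; first by exists A.
  exists (magnus_integrand n.+2); apply: magnus_prim => // -[//|k] kn.
  exact: IH.
move=> v; case: (ltngtP (size v) 1) => v1.
- case: v v1 => // _; apply: prim_eq (prim0 s) => u _ //.
  by rewrite /dexp_inv big_ord0.
- have := magnus_prim v1 (fun k => _) v.
  have h k : (0 < k < size v)%N -> exists W', tprimitive s (Om k) W' by case: k.
  move/(_ h); apply: prim_eq => u _ //; exact: dexp_inv_magnus_sum.
- have := Om1 v; apply: prim_eq => u _; first by rewrite /magnus_sum v1.
  by rewrite /dexp_inv v1 big_ord1 /= /bernoulli /= fact0 divr1 mul1r.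
Qed.

Lemma magnus_sum_cvg r v :
  series (fun k => Om k.+1 r v) n @[n --> \oo] --> magnus_sum r v.
Proof.
have -> : magnus_sum r v = \sum_(k < size v) Om k.+1 r v.
  rewrite /magnus_sum; case e: (size v) => [|n]; first by rewrite big_ord0.
  rewrite (bigD1 ord_max)//= big1 ?addr0// => k kn.
  by rewrite magnus_level//= e eqSS eq_sym.
apply: (@cvg_series_eventually0 _ (fun k => Om k.+1 r v)) => k vk.
by rewrite magnus_level//= ltn_eqF.
Qed.

Lemma magnus_summable r : tsummable (fun k => Om k.+1 r).
Proof. by move=> v; apply/cvg_ex; exists (magnus_sum r v); exact: magnus_sum_cvg. Qed.

Lemma magnus_tsum r : tsum (fun k => Om k.+1 r) = magnus_sum r.
Proof. by apply/funext => v; apply: cvg_lim => //; exact: magnus_sum_cvg. Qed.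

End MagnusTerms.

(** * A partial fraction identity *)

(** Lagrange interpolation of the constant 1 at the n + 1 distinct points [m k]
    returns the constant polynomial 1, whose coefficient of degree n > 0 is the
    sum up to the sign (-1)^n. *)
Lemma sum_prod_inv_diff (K : fieldType) n (m : 'I_n.+1 -> K) :
  injective m -> (0 < n)%N ->
  \sum_(k < n.+1) \prod_(l < n.+1 | l != k) (m l - m k)^-1 = 0.
Proof.
move=> mI n0.
pose D (k : 'I_n.+1) : {poly K} := \prod_(l < n.+1 | l != k) ('X - (m l)%:P).
pose c (k : 'I_n.+1) : K := \prod_(l < n.+1 | l != k) (m k - m l)^-1.
have sD k : size (D k) = n.+1.
  rewrite /D -big_filter size_prod_XsubC; congr _.+1.
  by rewrite size_filter -sum1_count sum1_card (cardC1 k) card_ord.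
have DE k j : (D k).[m j] = (k == j)%:R * (c k)^-1.
  rewrite /D /c horner_prod -prodfV; case: eqVneq => [<-|kj].
    by rewrite mul1r; apply: eq_bigr => l _; rewrite hornerXsubC invrK.
  by rewrite mul0r (bigD1 j) 1?eq_sym//= hornerXsubC subrr mul0r.
have c0 k : c k != 0.
  apply/prodf_neq0 => l lk; rewrite invr_eq0 subr_eq0.
  by apply: contra lk => /eqP/mI ->.
pose P := \sum_(k < n.+1) c k *: D k - 1.
have P0 : P = 0.
  apply: (@roots_geq_poly_eq0 _ P (map m (enum 'I_n.+1))).
  - apply/allP => _ /mapP[j _ ->]; rewrite /root /P hornerD hornerN hornerC horner_sum.
    rewrite (bigD1 j)//= big1 ?addr0 => [|k kj]; rewrite hornerZ DE.
      by rewrite eqxx mul1r divff ?subrr.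
    by rewrite (negbTE kj) mul0r mulr0.
  - by rewrite map_inj_uniq// enum_uniq.
  - rewrite size_map size_enum_ord (leq_trans (size_polyD _ _))// geq_max size_polyN
    size_poly1 andbT.
    rewrite (leq_trans (size_sum _ _ _))//; apply/bigmax_leqP => k _.
    by rewrite (leq_trans (size_scale_leq _ _))// sD.
have : P`_n = 0 by rewrite P0 coef0.
rewrite /P coefB coef1 gtn_eqF// subr0 coef_sum => cE.
rewrite (eq_bigr (fun k => (-1) ^+ n * (c k *: D k)`_n)); last first.
  move=> k _; rewrite coefZ.
  have -> : (D k)`_n = 1.
    have /monicP := monic_prod_XsubC (index_enum 'I_n.+1) (fun l => l != k) m.
    by rewrite /lead_coef -/(D k) sD.
  rewrite mulr1 /c -[n in _ ^+ n](_ : #|predC1 k| = n); last by rewrite cardC1 card_ord.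
  rewrite -prodr_const -big_split /=; apply: eq_bigr => l _.
  by rewrite -opprB mulN1r -invrN.
by rewrite -mulr_sumr cE mulr0.
Qed.

(** * The signature of a linear path *)

Section LinearPath.
Variables (R : realType) (d : nat) (lambda x : 'rV[R]_d).
Hypothesis lambda_gt0 : forall i, 0 < lambda 0 i.
Implicit Types (s : \bar R) (t r : R) (v w : word d).

Local Notation X := (fun u : R => u *: x).
Local Notation A := (fun t u : R => tD lambda (t - u) (tvec x)).
Local Notation mu v k := (wweight lambda (take k v)).

Lemma wweight_rcons w i : wweight lambda (rcons w i) = wweight lambda w + lambda 0 i.
Proof. by rewrite /wweight -cats1 big_cat big_seq1. Qed.

Lemma wweight_ge0 v : 0 <= wweight lambda v.
Proof. by apply: sumr_ge0 => i _; exact: ltW. Qed.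

Lemma wweight_take_lt v k l : (k < l <= size v)%N -> mu v k < mu v l.
Proof.
elim: v k l => [|i v IH] k [|l]; rewrite ?ltn0 ?andbF// => /andP[kl lv].
rewrite /= {2}/wweight big_cons; case: k kl => [|k] kl.
  by rewrite /wweight big_nil ltr_pwDl// -/(wweight lambda _) wweight_ge0.
by rewrite /wweight big_cons ltrD2l; apply: IH; rewrite -ltnS kl.
Qed.

Lemma wweight_take_inj v : injective (fun k : 'I_(size v).+1 => mu v k).
Proof.
move=> k l /= e; apply: val_inj; case: (ltngtP k l) => // kl.
  by have := @wweight_take_lt v k l; rewrite kl -ltnS ltn_ord e ltxx => /(_ isT).
by have := @wweight_take_lt v l k; rewrite kl -ltnS ltn_ord e ltxx => /(_ isT).
Qed.

Lemma tD_letter_level1 t u : level_in (pred1 1%N) (A t u).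
Proof. by case=> [|i [|j v]]//= _; rewrite /tD mulr0. Qed.

Lemma tD_tvec_letter t u i : A t u [:: i] = expR (- (lambda 0 i * (t - u))) * x 0 i.
Proof. by rewrite /tD /wweight big_seq1. Qed.

Lemma tD_letter_prim s t v : exists F, primitive s F (A t ^~ v).
Proof.
case: v => [|i [|j v]].
- by eexists; apply: eq_primr (prim0 s) => u _; rewrite (@tD_letter_level1 t u).
- eexists; apply: eq_primr (primZ (x 0 i) (prim_exp_shift s t (lambda_gt0 i))) => u _.
  by rewrite tD_tvec_letter mulrC.
- by eexists; apply: eq_primr (prim0 s) => u _; rewrite (@tD_letter_level1 t u).
Qed.

Lemma efm_sigE s t (Y : R -> tens R d) : (s <= t%:E)%E ->
  (forall r, Y r [::] = 1) ->
  (forall w i, primitive s (fun r => Y r (rcons w i))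
     (fun u => Y u w * (expR (- (lambda 0 i * (t - u))) * x 0 i))) ->
  efm_sig lambda X s t = Y t.
Proof. by move=> st Y0 pY; apply/funext => v; apply: efm_iterE. Qed.

(** The exponential of the sum of the Magnus terms satisfies the integral
    equations of the signature: its derivative is its product with [A t], which
    is concentrated on words of one letter. *)
Lemma efm_sig_magnus s t : (s <= t%:E)%E ->
  efm_sig lambda X s t = texp (tsum (fun k => magnus s (A t) k.+1 t)).
Proof.
move=> st; have A1 := @tD_letter_level1 t; have Ap := tD_letter_prim s t.
rewrite (magnus_tsum s A1); pose W := magnus_sum s (A t).
apply: (@efm_sigE s t (fun r => texp (W r)) st) => [r|w i]; first exact: texp_nil.
have A0 u : A t u [::] = 0 by exact: A1.
have w0 : rcons w i != [::] by case: (w).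
apply: eq_primr (prim_texp (fun u => erefl) A0 (magnus_sum_prim A1 Ap) w0) => u _.
by rewrite tmul_rcons_level1 ?tD_tvec_letter//; exact: A1.
Qed.

Definition efm_stationary v : R :=
  (\prod_(i <- v) x 0 i) * \prod_(1 <= k < (size v).+1) (mu v k)^-1.

Lemma efm_stationary_rcons w i : efm_stationary (rcons w i) =
  (wweight lambda (rcons w i))^-1 * (efm_stationary w * x 0 i).
Proof.
rewrite /efm_stationary prod_rcons size_rcons big_nat_recr//=.
rewrite take_rcons_all.
rewrite (@eq_big_nat _ _ _ _ _ _ (fun k => (mu w k)^-1)); first by ring.
by move=> k; rewrite ltnS => /andP[_ kw]; rewrite -cats1 takel_cat.
Qed.

(** At intermediate times r the coefficient of [v] in the integral equations is
    the stationary one times e^(-mu (t - r)), with mu the weight of [v]. *)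
Lemma efm_sig_stationary t v : efm_sig lambda X -oo%E t v = efm_stationary v.
Proof.
rewrite (@efm_sigE -oo%E t (fun r v =>
  efm_stationary v * expR (- (wweight lambda v * (t - r))))).
- by rewrite subrr mulr0 oppr0 expR0 mulr1.
- by rewrite leNye.
- move=> r; rewrite /efm_stationary /wweight /= !big_nil mul0r oppr0 expR0.
  by rewrite !mulr1.
move=> w i; have a0 : 0 < wweight lambda (rcons w i).
  by rewrite wweight_rcons ltr_wpDl// wweight_ge0.
apply: prim_eq (primZ (efm_stationary w * x 0 i) (prim_exp_shift -oo%E t a0)) => u _.
  by rewrite efm_stationary_rcons /= mulr0 subr0; ring.
by rewrite wweight_rcons mulrDl opprD expRD; ring.
Qed.

(** Each application of [tH] appends one letter and divides by the weight of
    the resulting word, which builds up the product of the weights of the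
    prefixes. *)
Lemma iter_tH k v : iter k (tH lambda x) (@tone R d) v =
  (size v == k)%:R * efm_stationary v.
Proof.
elim: k v => [|k IH] v.
  rewrite /= /tone size_eq0; case: eqP => [->|]; last by rewrite mul0r.
  by rewrite /efm_stationary big_nil big_geq// !mulr1.
elim/last_ind: v => [|w i _]; first by rewrite /= mul0r.
have -> : iter k.+1 (tH lambda x) (@tone R d) (rcons w i) =
   (wweight lambda (rcons w i))^-1 *
     tmul (iter k (tH lambda x) (@tone R d)) (tvec x) (rcons w i).
  by rewrite iterS /tH /tLambda_dag; case: (w).
rewrite tmul_rcons_level1; last by case=> [|? [|]].
by rewrite IH efm_stationary_rcons size_rcons eqSS /=; ring.
Qed.

Lemma iter_tH_cvg v :
  series (fun k => iter k (tH lambda x) (@tone R d) v) n @[n --> \oo] -->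
  efm_stationary v.
Proof.
have -> : efm_stationary v = \sum_(k < (size v).+1) iter k (tH lambda x) (@tone R d) v.
  rewrite (bigD1 ord_max)//= big1 ?addr0 => [|k kv]; rewrite iter_tH.
    by rewrite eqxx mul1r.
  by have -> : (size v == k) = false; [apply/negbTE; rewrite eq_sym|rewrite mul0r].
apply: (@cvg_series_eventually0 _ (fun k => iter k (tH lambda x) (@tone R d) v))
  => k vk.
by rewrite iter_tH ltn_eqF ?mul0r.
Qed.

Definition efm_coef v k : R :=
  \prod_(l < (size v).+1 | l != k :> nat) (mu v l - mu v k)^-1.

Lemma efm_coef_rcons w i k : (k <= size w)%N ->
  efm_coef (rcons w i) k =
  efm_coef w k / (wweight lambda (rcons w i) - mu w k).
Proof.
move=> kw; have tk l : (l <= size w)%N -> take l (rcons w i) = take l w.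
  by move=> lw; rewrite -cats1 takel_cat.
rewrite /efm_coef size_rcons big_mkcond big_ord_recr /= -big_mkcond /=.
rewrite gtn_eqF//= take_rcons_all tk//; congr (_ * _).
by apply: eq_bigr => l _; rewrite tk// -ltnS.
Qed.

Lemma efm_coef_sum v : v != [::] -> \sum_(k < (size v).+1) efm_coef v k = 0.
Proof.
by rewrite -size_eq0 -lt0n => v0; exact: sum_prod_inv_diff (@wweight_take_inj v) v0.
Qed.

(** At an intermediate time r, the coefficient of [v] in the integral
    equations is the combination of the e^(-mu_k (t - s)) e^(-(mu_n - mu_k) (t - r)),
    with n the length of [v].  All its exponents in r become positive once it is
    multiplied by the exponential of the next letter, so that it can be integrated
    term by term. *)
Lemma efm_sig_explicit (s t : R) v : s <= t ->
  efm_sig lambda X s%:E t v =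
  (\prod_(i <- v) x 0 i) *
    \sum_(k < (size v).+1) efm_coef v k * expR (- (mu v k * (t - s))).
Proof.
move=> st; pose e (a r : R) := expR (- (a * (t - r))).
pose Y r v := (\prod_(i <- v) x 0 i) * \sum_(k < (size v).+1)
  efm_coef v k * e (mu v k) s * e (wweight lambda v - mu v k) r.
have eD a b r : e (a + b) r = e a r * e b r.
  by rewrite /e -expRD; congr expR; ring.
rewrite (@efm_sigE s%:E t Y).
- rewrite /Y; congr (_ * _); apply: eq_bigr => k _.
  by rewrite {2}/e subrr mulr0 oppr0 expR0 mulr1.
- by rewrite lee_fin.
- move=> r; rewrite /Y /= big_nil big_ord1 /efm_coef big1 => [|l]; last by rewrite ord1.
  by rewrite /wweight /= big_nil /e subr0 !mul0r !oppr0 expR0 !mulr1.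
move=> w i; pose a k := wweight lambda (rcons w i) - mu w k.
have a0 k : 0 < a k.
  rewrite subr_gt0 wweight_rcons ltr_pwDr//.
  by rewrite -{2}(cat_take_drop k w) /wweight big_cat /= lerDl -/(wweight lambda _)
    wweight_ge0.
have E r b : expR (- (b * t)) * expR (b * r) = e b r.
  by rewrite -expRD /e; congr expR; ring.
have := @prim_sum R s%:E _ (index_enum 'I_(size w).+1) predT _ _ (fun k _ =>
  primZ ((\prod_(j <- w) x 0 j) * x 0 i * efm_coef w k * e (mu w k) s)
    (prim_exp_shift s%:E t (a0 k))).
apply: prim_eq => u _; last first.
  rewrite /Y mulr_sumr mulr_suml; apply: eq_bigr => k _.
  rewrite -/(e (a k) u) -/(e (lambda 0 i) u).
  have -> : e (a k) u = e (wweight lambda w - mu w k) u * e (lambda 0 i) u.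
    by rewrite -eD /a wweight_rcons addrAC.
  ring.
pose ew := e (wweight lambda (rcons w i)) s.
rewrite /Y prod_rcons size_rcons [in RHS]big_ord_recr /=.
have w0 : rcons w i != [::] by case: (w).
have := efm_coef_sum w0; rewrite size_rcons big_ord_recr /= => /eqP.
(* With n the length of w, the coefficient for k = n + 1 is minus the sum of the
  others: it collects
   the boundary terms at s of the n + 1 integrals. *)
rewrite addrC addr_eq0 => /eqP ->.
have e0 : e 0 u = 1 by rewrite /e mul0r oppr0 expR0.
rewrite take_rcons_all subrr e0 mulr1.
rewrite -/ew mulNr mulr_suml -sumrB mulr_sumr; apply: eq_bigr => k _.
have kw : (k <= size w)%N by rewrite -ltnS.
have -> : take k (rcons w i) = take k w by rewrite -cats1 takel_cat.
rewrite efm_coef_rcons// -/(a k) -/(e _ _) E.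
have -> : ew = e (mu w k) s * e (a k) s by rewrite -eD /a addrC subrK.
ring.
Qed.

End LinearPath.

Section EqualWeights.
Variables (R : realType) (d : nat).

(** The scalar [g] is the primitive of e^(-lbar (t - u)) vanishing at [s], and
    the powers of [g] integrate by the chain rule [primX].  Without letters the
    sign of [lbar] is unknown, which is why its positivity is deduced from a
    letter. *)
Lemma efm_sig_equal_weights (lambda x : 'rV[R]_d) (s : \bar R) (t lbar : R) :
  (forall i, 0 < lambda 0 i) -> (forall i, lambda 0 i = lbar) -> (s <= t%:E)%E ->
  efm_sig lambda (fun u => u *: x) s t =
  texp (tvec (((1 - expR (- (lbar * t)) * exp_start s lbar) / lbar) *: x)).
Proof.
move=> lambda_gt0 lE st.
pose g r := (expR (- (lbar * (t - r))) - expR (- (lbar * t)) * exp_start s lbar) / lbar.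
rewrite (@efm_sigE _ _ lambda x s t (fun r => texp (tvec (g r *: x))) st).
- by rewrite /g subrr mulr0 oppr0 expR0.
- by move=> r; rewrite texp_nil.
move=> w i; have l0 : 0 < lbar by rewrite -(lE i).
have pg := prim_exp_shift s t l0.
have E r v : texp (tvec (g r *: x)) v =
    (size v)`!%:R^-1 * g r ^+ size v * \prod_(j <- v) x 0 j.
  rewrite texp_tvec -mulrA; congr (_ * _).
  elim: v => [|j v IH]; first by rewrite !big_nil expr0 mulr1.
  by rewrite !big_cons IH mxE exprS; ring.
apply: prim_eq (primZ ((size w).+1`!%:R^-1 * \prod_(j <- rcons w i) x 0 j)
  (primX (size w) pg)) => u _; rewrite E ?size_rcons.
  by rewrite -/(g u); ring.
rewrite -/(g u) prod_rcons lE factS natrM invfM.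
have a : ((size w).+1%:R : R) != 0 by rewrite pnatr_eq0.
have b : ((size w)`!%:R : R) != 0 by rewrite pnatr_eq0 -lt0n fact_gt0.
move: ((size w).+1%:R : R) ((size w)`!%:R : R) a b => p q a b.
by field; rewrite b a.
Qed.

End EqualWeights.

Theorem theorem4p4 (R : realType) (d : nat) (lambda x : 'rV[R]_d)
    (lambda_gt0 : forall i : 'I_d, 0 < lambda 0 i) :
  let X := fun u : R => u *: x in
  let A := fun t u : R => tD lambda (t - u) (tvec x) in
  let Omega := fun (k : nat) (s : \bar R) (t : R) => magnus s (A t) k t in
  let mu := fun (v : word d) (k : nat) => wweight lambda (take k v) in
  let c := fun (v : word d) (k : nat) =>
    \prod_(l < (size v).+1 | l != k :> nat) (mu v l - mu v k)^-1 in
  [/\ (* Magnus representation and the H-series *)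
      (forall s t : R, s <= t ->
         tsummable (fun k => Omega k.+1 s%:E t) /\
         efm_sig lambda X s%:E t = texp (tsum (fun k => Omega k.+1 s%:E t))),
      (forall t : R,
         [/\ tsummable (fun k => Omega k.+1 -oo%E t),
             efm_sig lambda X -oo%E t =
               texp (tsum (fun k => Omega k.+1 -oo%E t)),
             tsummable (fun k => iter k (tH lambda x) (@tone R d)) &
             efm_sig lambda X -oo%E t =
               tsum (fun k => iter k (tH lambda x) (@tone R d))]),
      (* explicit coefficients *)
      (forall (s t : R) (v : word d), s <= t ->
         efm_sig lambda X s%:E t v =
           (\prod_(i <- v) x 0 i) *
           \sum_(k < (size v).+1) c v k * expR (- (mu v k * (t - s)))),
      (forall (t : R) (v : word d),
         efm_sig lambda X -oo%E t v =
           (\prod_(i <- v) x 0 i) *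
           \prod_(1 <= k < (size v).+1) (mu v k)^-1) &
      (* equal weights *)
      (forall lbar : R, (forall i : 'I_d, lambda 0 i = lbar) ->
         (forall s t : R, s <= t ->
            efm_sig lambda X s%:E t =
              texp (tvec (((1 - expR (- (lbar * (t - s)))) / lbar) *: x))) /\
         (forall t : R,
            efm_sig lambda X -oo%E t = texp (tvec (lbar^-1 *: x))))].
Proof.
split.
- move=> s t st; split; last by apply: efm_sig_magnus => //; rewrite lee_fin.
  exact: (@magnus_summable _ _ s%:E _ (@tD_letter_level1 _ _ lambda x t) t).
- move=> t; split.
  + exact: (@magnus_summable _ _ -oo%E _ (@tD_letter_level1 _ _ lambda x t) t).
  + by apply: efm_sig_magnus => //; rewrite leNye.
  + by move=> v; apply/cvg_ex; exists (efm_stationary lambda x v); exact: iter_tH_cvg.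
  + apply/funext => v; rewrite efm_sig_stationary//.
    by apply/esym/cvg_lim => //; exact: iter_tH_cvg.
- by move=> s t v st; exact: efm_sig_explicit.
- by move=> t v; exact: efm_sig_stationary.
- move=> lbar lE; split=> [s t st|t].
    rewrite (efm_sig_equal_weights x lambda_gt0 lE) ?lee_fin//=.
    rewrite -expRD (_ : - (lbar * t) + lbar * s = - (lbar * (t - s)))//.
    by ring.
  by rewrite (efm_sig_equal_weights x lambda_gt0 lE) ?leNye//= mulr0 subr0 mul1r.
Qed.
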